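(* There exist positive numerical constants $\kappa$ and $c$ such that, for any $\alpha\in(0,1)$, the following holds for any $\theta\in\mathbb{R}^n$, any $(\kappa,\zeta_{1-\alpha}^2)$-high-energy change-point $\tau_k^*$ of $\theta$ and any $\tau\in\{2,\dots,n\}$. If $$|\tau-\tau_k^*|<\frac{\min(\tau_k^*-\tau_{k-1}^*,\ \tau_{k+1}^*-\tau_k^* )}{4},$$ then, for any $x>0$, $$\mathbb{P}_\theta\left(|\mathcal{L}(\tau)-\tau_k^*|\mathbf{1}_{\mathcal{B}_{1-\alpha}}\geq c\,\frac{\max(x,1)}{\Delta_k^2}\right)\leq e^{-x}.$$
   Context: Model: $Y_i=\theta_i+\epsilon_i$, $i=1,\dots,n$, where $\epsilon_1,\dots,\epsilon_n$ are independent, mean-zero and satisfy $\mathbb{E}[e^{t\epsilon_i}]\leq e^{t^2/2}$ for all $t\in\mathbb{R}$; $\mathbb{P}_\theta$ is the distribution under mean $\theta$. Any $\theta\in\mathbb{R}^n$ is uniquely described by integers $1=\tau_0^*<\tau_1^*<\dots<\tau_K^*<\tau_{K+1}^*=n+1$ ($0\le K\le n-1$) and reals $\mu_1,\dots,\mu_{K+1}$ with $\mu_k\neq\mu_{k+1}$ and $\theta_i=\mu_k$ for $\tau_{k-1}^*\leq i<\tau_k^*$; the change-points are $\tau_1^*,\dots,\tau_K^*$ and $\Delta_k=\mu_{k+1}-\mu_k$. The change-point $\tau_k^*$ is $(\kappa,q)$-high-energy if $$|\Delta_k|\sqrt{\frac{(\tau^*_k-\tau^*_{k-1})(\tau^*_{k+1}-\tau^*_k)}{\tau^*_{k+1}-\tau^*_{k-1}}}>\kappa\sqrt{2\log\left(\frac{n(\tau^*_{k+1}-\tau^*_{k-1})}{(\tau^*_{k+1}-\tau^*_k)(\tau^*_k-\tau^*_{k-1})}\right)+q}.$$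 $\mathcal{T}_3$ is the set of integer triplets $t=(t_1,t_2,t_3)$ with $1\leq t_1<t_2<t_3\leq n+1$. For such $t$ put $S(t)=\sqrt{\frac{(t_2-t_1)(t_3-t_2)}{t_3-t_1}}$, $\lambda(t)=\sqrt{2\log\left(\frac{n(t_3-t_1)}{(t_3-t_2)(t_2-t_1)}\right)}$, $C(Y,t)=\left[\frac{\sum_{i=t_2}^{t_3-1}Y_i}{t_3-t_2}-\frac{\sum_{i=t_1}^{t_2-1}Y_i}{t_2-t_1}\right]S(t)$, and $N(t)$ the same expression with $\epsilon_i$ in place of $Y_i$. $\zeta_{1-\alpha}$ is the smallest number such that $\mathbb{P}\left[\sup_{t\in\mathcal{T}_3}(|N(t)|-\lambda(t))>\zeta_{1-\alpha}\right]\leq\alpha$, and $\mathcal{B}_{1-\alpha}=\{|N(t)|\leq\lambda(t)+\zeta_{1-\alpha}\ \forall t\in\mathcal{T}_3\}$. For $\tau\in\{2,\dots,n\}$ and a positive integer $r$ (or $r=+\infty$), $t^{(\tau,r)}=(\max(\tau-r,1),\tau,\min(\tau+r,n+1))$. Let $\widehat r_\tau=\min\{r\geq1:\ |C(Y,t^{(\tau,r)})|>\lambda(t^{(\tau,r)})+\zeta_{1-\alpha}\}$ (with $\min\emptyset=+\infty$) and $\underline{I}_\tau=[t_1^{(\tau,\widehat r_\tau)}+1,\ t_3^{(\tau,\widehat r_\tau)}-1]$. With $(a,\tau,b)=t^{(\tau,2\widehat r_\tau-1)}$, let $Y^{(\tau)}=(Y_a,\dots,Y_{b-1})$. The locally improved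 position $\mathcal{L}(\tau)$ is any minimizer, over integers $\tau'\in\underline{I}_\tau$, of the restricted least-squares criterion $\|Y^{(\tau)}-\Pi_{\tau'}Y^{(\tau)}\|^2$, where $\Pi_{\tau'}$ is the orthogonal projection onto the vectors indexed by $\{a,\dots,b-1\}$ that are constant on $\{a,\dots,\tau'-1\}$ and on $\{\tau',\dots,b-1\}$; equivalently, any maximizer of $|C(Y,(a,\tau',b))|$ over $\tau'\in\underline{I}_\tau$. *)

(* Defs.v *)
From HB Require Import structures.
From mathcomp Require Import all_boot all_order all_algebra.
From mathcomp Require Import all_classical all_reals all_analysis.

Set Implicit Arguments.
Unset Strict Implicit.
Unset Printing Implicit Defensive.

Import Order.TTheory GRing.Theory Num.Theory.
Import numFieldNormedType.Exports.

Local Open Scope classical_set_scope.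
Local Open Scope ring_scope.

(* Coordinates are numbered 1, ..., n in the mathematics: the ordinal           *)
(* i : 'I_n stands for the position i.+1.                                       *)

Definition triplet : Type := (nat * nat * nat)%type.

Definition T3 (n : nat) : set triplet :=
  [set t | let: (t1, t2, t3) := t in
    [&& (1 <= t1)%N, (t1 < t2)%N, (t2 < t3)%N & (t3 <= n.+1)%N]].

Section Cusum.
Variables (R : realType) (n : nat).

Definition scale (t : triplet) : R :=
  let: (t1, t2, t3) := t in
  Num.sqrt ((t2 - t1)%:R * (t3 - t2)%:R / (t3 - t1)%:R).

Definition penalty (t : triplet) : R :=
  let: (t1, t2, t3) := t in
  2 * ln (n%:R * (t3 - t1)%:R / ((t3 - t2)%:R * (t2 - t1)%:R)).

Definition lambda (t : triplet) : R := Num.sqrt (penalty t).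

Definition segment_mean (y : 'I_n -> R) (s e : nat) : R :=
  (\sum_(i < n | (s <= i.+1 < e)%N) y i) / (e - s)%:R.

Definition cusum (y : 'I_n -> R) (t : triplet) : R :=
  let: (t1, t2, t3) := t in
  (segment_mean y t2 t3 - segment_mean y t1 t2) * scale t.

End Cusum.

Section Noise.
Context d (T : measurableType d) (R : realType) (P : probability T R) (n : nat).
Variable eps : 'I_n -> {RV P >-> R}.

Definition mutually_independent : Prop :=
  forall (J : {set 'I_n}) (A : 'I_n -> set R),
    (forall i, measurable (A i)) ->
    P (\bigcap_(i in [set` J]) (eps i @^-1` A i)) =
    (\prod_(i in J) P (eps i @^-1` A i))%E.

Definition centered : Prop := forall i, 'E_P[eps i]%E = 0%E.

Definition subgaussian : Prop :=
  forall i (t : R), ('M_P (eps i) t <= (expR (t ^+ 2 / 2))%:E)%E.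

Definition noise_cusum (t : triplet) (w : T) : R :=
  cusum (fun i => eps i w) t.

Definition sup_noise (w : T) : R :=
  sup [set `|noise_cusum t w| - lambda R n t | t in T3 n].

(* z is zeta_{1 - alpha}: the smallest number z such that                       *)
(* P[sup_noise > z] <= alpha.                                                   *)
Definition is_critical_value (alpha z : R) : Prop :=
  (P [set w | (z < sup_noise w)%R] <= alpha%:E)%E /\
  forall z' : R, (P [set w | (z' < sup_noise w)%R] <= alpha%:E)%E -> z <= z'.

Definition good_event (zeta : R) : set T :=
  [set w | forall t, T3 n t -> `|noise_cusum t w| <= lambda R n t + zeta].

End Noise.

Section ChangePoints.
Variables (R : realType) (n : nat).

(* Only the values tau 0, ..., tau K.+1 and mu 1, ..., mu K.+1 are meaningful.  *)
Definition piecewise_description (theta : 'I_n -> R)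
    (K : nat) (tau : nat -> nat) (mu : nat -> R) : Prop :=
  [/\ tau 0%N = 1%N /\ tau K.+1 = n.+1,
      forall k, (k <= K)%N -> (tau k < tau k.+1)%N,
      forall k, (1 <= k <= K)%N -> mu k != mu k.+1 &
      forall k (i : 'I_n), (1 <= k <= K.+1)%N ->
        (tau k.-1 <= i.+1 < tau k)%N -> theta i = mu k].

Definition jump (mu : nat -> R) (k : nat) : R := mu k.+1 - mu k.

Definition high_energy (kappa q : R) (tau : nat -> nat) (mu : nat -> R)
    (k : nat) : Prop :=
  let t := (tau k.-1, tau k, tau k.+1) in
  `|jump mu k| * scale R t > kappa * Num.sqrt (penalty R n t + q).

End ChangePoints.

Section LocalImprovement.
Variables (R : realType) (n : nat).

(* t^(tau, r); the radius r = +oo is encoded as None.                           *)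
Definition sym_triplet (tau : nat) (r : option nat) : triplet :=
  if r is Some r' then (maxn (tau - r') 1, tau, minn (tau + r') n.+1)%N
  else (1, tau, n.+1)%N.

Definition detects (y : 'I_n -> R) (zeta : R) (tau r : nat) : bool :=
  (1 <= r)%N &&
  (`|cusum y (sym_triplet tau (Some r))|
     > lambda R n (sym_triplet tau (Some r)) + zeta).

Definition radius (y : 'I_n -> R) (zeta : R) (tau : nat) : option nat :=
  match pselect (exists r, detects y zeta tau r) with
  | left ex_r => Some (ex_minn ex_r)
  | right _ => None
  end.

Definition search_interval (y : 'I_n -> R) (zeta : R) (tau : nat) : set nat :=
  let: (t1, _, t3) := sym_triplet tau (radius y zeta tau) in
  [set l | (t1 + 1 <= l <= t3 - 1)%N].

Definition window (a b : nat) : finType := {i : 'I_n | (a <= i.+1 < b)%N}.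

Definition restrict (y : 'I_n -> R) (a b : nat) : {ffun window a b -> R} :=
  [ffun i => y (val i)].

(* The vectors indexed by {a, ..., b-1} that are constant on {a, ..., l-1} and  *)
(* on {l, ..., b-1}.                                                            *)
Definition two_piece (a l b : nat) : set {ffun window a b -> R} :=
  [set v | forall i j : window a b,
     ((val i).+1 < l)%N = ((val j).+1 < l)%N -> v i = v j].
Arguments two_piece a l b : clear implicits.

Definition dot (I : finType) (u v : {ffun I -> R}) : R := \sum_i u i * v i.

(* xget picks the unique p with p \in V and u - p orthogonal to V; the default  *)
(* 0 is never used when V is a linear subspace.                                 *)
Definition orth_proj (I : finType) (V : set {ffun I -> R}) (u : {ffun I -> R}) :
    {ffun I -> R} :=
  xget 0 [set p | V p /\ forall v, V v -> dot (u - p) v = 0].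

Definition ls_criterion (y : 'I_n -> R) (a b l : nat) : R :=
  let u := restrict y a b in
  let res := u - orth_proj (two_piece a l b) u in
  dot res res.

Definition outer_triplet (y : 'I_n -> R) (zeta : R) (tau : nat) : triplet :=
  sym_triplet tau (omap (fun r => 2 * r - 1)%N (radius y zeta tau)).

(* l is an admissible value of the locally improved position L(tau).            *)
Definition is_improved (y : 'I_n -> R) (zeta : R) (tau l : nat) : Prop :=
  let: (a, _, b) := outer_triplet y zeta tau in
  search_interval y zeta tau l /\
  forall l', search_interval y zeta tau l' ->
    ls_criterion y a b l <= ls_criterion y a b l'.

End LocalImprovement.

(* Main.v *)
(* On the event B, the energy condition forces detection at a radius so small   *)
(* that the window of radius 2 r - 1 around tau contains no change-point other  *)
(* than tau_k; and tau_k lies in the search interval, since otherwise the       *)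
(* detecting CUSUM would be pure noise.                                         *)
(*   Moving the split of the window from tau_k to a position at distance j      *)
(* changes the explained sum of squares by                                      *)
(*   p j / (p + j) (m_A - m_J)^2 - j q / (j + q) (m_J - m_B)^2,                 *)
(* where A, J, B are the three resulting blocks, of lengths p, j, q, and m_ is  *)
(* the mean of a block. Both p and q are at least j / 2, so this is positive as *)
(* soon as the partial sums of the noise started at tau_k, in either direction, *)
(* satisfy |S_h| <= h |Delta| / 20 for all h >= j / 2.                          *)
(*   This condition does not involve the random window, and it fails with       *)
(* probability at most 4 exp (- Delta^2 j / 1600) by Ville's maximal inequality *)
(* applied to the supermartingales exp (t S_h - t^2 h / 2), t = +-Delta / 20.   *)

(* The argument separates a deterministic part from a single probabilistic estimate. Deterministic
   part: on the good event [radius_detected] confines the random window between the neighbouring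
   change-points, and [ls_criterionE] turns the least-squares comparison into one of explained sums
   of squares. [better_split_noise] then shows that a split far from the change-point loses to the
   change-point itself, which is an admissible competitor; [improved_close] puts this together.
   Probabilistic part: [segment_sum_maximal] bounds the partial sums on both sides of the
   change-point, for all lengths at least [h0] at once. The exceptional event is fixed before the
   window and the minimizer are known, so no union bound over windows, splits or lengths is paid.
   Taking [h0] of order max(x, 1) / Delta^2 gives the stated rate. *)
Require Import Defs.
From HB Require Import structures.
From mathcomp Require Import all_boot all_order all_algebra.
From mathcomp Require Import all_classical all_reals all_analysis.
From mathcomp Require Import measurable_realfun ring lra zify.

Set Implicit Arguments.
Unset Strict Implicit.
Unset Printing Implicit Defensive.

Import Order.TTheory GRing.Theory Num.Theory.
Import numFieldNormedType.Exports.

Local Open Scope classical_set_scope.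
Local Open Scope ring_scope.

(** * Independence *)

Section Independence.
Context d (T : measurableType d) (R : realType) (P : probability T R) (n : nat).
Variable eps : 'I_n -> {RV P >-> R}.

(* A pi-system generating the sigma-algebra of the eps i, i in J. *)
Definition boxes (J : {set 'I_n}) : set (set T) :=
  [set D | exists2 A : 'I_n -> set R, (forall i, measurable (A i)) &
           D = \bigcap_(i in [set` J]) (eps i @^-1` A i)].

Lemma boxes_measurable J : boxes J `<=` measurable.
Proof.
move=> _ [A mA ->]; apply: fin_bigcap_measurable.
  exact: finite_finset.
by move=> i _; rewrite -[X in measurable X]setTI; exact: measurable_funPT.
Qed.

Lemma setI_closed_boxes J : setI_closed (boxes J).
Proof.
move=> _ _ [A mA ->] [B mB ->]; exists (fun i => A i `&` B i).
  by move=> i; exact: measurableI.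
by rewrite -bigcapI.
Qed.

Lemma boxesT J : boxes J setT.
Proof.
exists (fun=> setT) => [//|]; apply/esym; rewrite -subTset => w _ i _.
by rewrite /preimage /=.
Qed.

Lemma boxes_preim (J : {set 'I_n}) (i : 'I_n) (A : set R) :
  i \in J -> measurable A ->
  boxes J (eps i @^-1` A).
Proof.
move=> iJ mA; exists (fun j => if j == i then A else setT).
  by move=> j; case: ifP.
apply/seteqP; split=> w /=.
  by move=> Aw j _ /=; case: eqP => [->|].
by move=> /(_ i iJ) /=; rewrite eqxx.
Qed.

Lemma measurable_fun_boxes (J : {set 'I_n}) (i : 'I_n) : i \in J ->
  measurable_fun [set: g_sigma_algebraType (boxes J)] (eps i).
Proof.
move=> iJ _ A mA; rewrite setTI; apply: sub_sigma_algebra.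
exact: boxes_preim.
Qed.

Lemma sub_boxes (J J' : {set 'I_n}) : J \subset J' ->
  <<s boxes J>> `<=` <<s boxes J'>>.
Proof.
move=> JJ'; apply: smallest_sub; first exact: smallest_sigma_algebra.
move=> _ [A mA ->]; apply: sub_sigma_algebra.
exists (fun i => if i \in J then A i else setT); first by move=> i; case: ifP.
apply/seteqP; split=> w /= H i Hi.
  by rewrite /preimage /=; case: ifP => // iJ; exact: (H i iJ).
by have := H i (fintype.subsetP JJ' _ Hi); rewrite /preimage /= (Hi : i \in J).
Qed.

Lemma sigma_boxes_measurable J : <<s boxes J>> `<=` measurable.
Proof.
apply: smallest_sub; [exact: sigma_algebra_measurable|exact: boxes_measurable].
Qed.

Hypothesis indep : mutually_independent eps.

(** With E the preimage of B, the finite measures D -> P(D n E) and D -> P(E) P(D) agree on the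
    pi-system [boxes J] by independence over [i |: J], hence on the sigma-algebra it generates. *)
Lemma indep_boxes (J : {set 'I_n}) (i : 'I_n) (D : set T) (B : set R) :
  i \notin J -> <<s boxes J>> D -> measurable B ->
  (P (D `&` eps i @^-1` B) = P D * P (eps i @^-1` B))%E.
Proof.
move=> iJ sD mB.
have mE : measurable (eps i @^-1` B).
  by rewrite -[X in measurable X]setTI; exact: measurable_funPT.
have PEfin : P (eps i @^-1` B) \is a fin_num by exact: fin_num_measure.
have PE0 : 0 <= fine (P (eps i @^-1` B)) by exact: fine_ge0.
pose m1 := mrestr P mE.
pose m2 := mscale (NngNum PE0) P.
suff : m1 D = m2 D.
  move=> m12; transitivity (m1 D) => //; rewrite m12 muleC.
  by congr (_ * _)%E; exact: fineK.
apply: (@g_sigma_algebra_measure_unique d R T (boxes J)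
  (@boxes_measurable J) (fun=> setT) _ _ m1 m2) => //.
- by move=> _; exact: boxesT.
- by apply/seteqP; split => // w _; exists 0%N.
- exact: setI_closed_boxes.
- move=> _ [A mA ->]; rewrite /m1 /m2 /mrestr.
  pose p := \bigcap_(j in [set` J]) (eps j @^-1` A j).
  transitivity (P (eps i @^-1` B) * P p)%E; last first.
    by congr (_ * _)%E; rewrite [RHS]fineK.
  pose A' j := if j == i then B else A j.
  have mA' j : measurable (A' j) by rewrite /A'; case: ifP.
  have := indep (i |: J) mA'; rewrite big_setU1 //= (_ : A' i = B); last first.
    by rewrite /A' eqxx.
  have -> : (\prod_(j in J) P (eps j @^-1` A' j) =
             \prod_(j in J) P (eps j @^-1` A j))%E.
    apply: eq_bigr => j jJ; rewrite /A'; case: eqP => // ji.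
    by rewrite ji (negbTE iJ) in jJ.
  rewrite -indep // => <-; congr (P _).
  apply/seteqP; split => w /=.
    move=> [H Hi] j; rewrite /= in_setU1 /preimage /A' /=.
    by case: eqP => [->//|_ /= jJ]; exact: H.
  move=> H; split.
    move=> j /= jJ; have := H j; rewrite /= in_setU1 jJ orbT => /(_ isT).
    by rewrite /preimage /A' /=; case: eqP => // ji; rewrite -ji jJ in iJ.
  by have := H i; rewrite /= in_setU1 eqxx /preimage /A' /= eqxx; apply.
- by move=> k; rewrite /m1 /mrestr /= -ge0_fin_numE // fin_num_measure // setTI.
Qed.

(** By [indep_boxes] the joint law of X and [eps i] is the product of their laws; Tonelli then
    factors the integral. *)
Lemma indep_expectation (J : {set 'I_n}) (i : 'I_n) (X : T -> R) (g : R -> R) :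
  i \notin J -> measurable_fun [set: g_sigma_algebraType (boxes J)] X ->
  (forall w, 0 <= X w) -> measurable_fun setT g -> (forall r, 0 <= g r) ->
  (\int[P]_w (X w * g (eps i w))%:E =
   \int[P]_w (X w)%:E * \int[P]_w (g (eps i w))%:E)%E.
Proof.
move=> iJ mX' X0 mg g0.
have mX : measurable_fun [set: T] X.
  move=> _ A mA; apply: (@sigma_boxes_measurable J).
  exact: mX'.
pose Y : T -> R * R := fun w => (X w, eps i w).
have mY : measurable_fun setT Y by apply: measurable_fun_pair.
pose XR : {RV P >-> R} := HB.pack X (isMeasurableFun.Build _ _ _ _ X mX).
pose YR : {RV P >-> (R * R)%type} :=
  HB.pack Y (isMeasurableFun.Build _ _ _ _ Y mY).
pose muX := distribution P XR.
pose muE := distribution P (eps i).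
have muE_prod Z : measurable Z -> (muX \x muE)%E Z = distribution P YR Z.
  apply: product_measure_unique => A B mA mB.
  rewrite /distribution /pushforward /=.
  rewrite -(@indep_boxes J i (X @^-1` A) B) //.
  by rewrite -[X in <<s _ >> X]setTI; exact: mX'.
(* X is truncated below so that the integrand of Tonelli's theorem is           *)
(* nonnegative on all of R * R.                                                 *)
pose f : R * R -> \bar R := fun z => (Num.max z.1 0 * g z.2)%:E.
have mf : measurable_fun [set: R * R] f.
  apply/measurable_EFinP/measurable_funM.
    by apply: measurable_maxr => //; exact: measurable_fst.
  by apply: measurableT_comp => //; exact: measurable_snd.
have f0 z : (0 <= f z)%E.
  by rewrite lee_fin mulr_ge0 // le_max lexx orbT.
transitivity (\int[distribution P YR]_z f z)%E.
  rewrite ge0_integral_distribution //; apply: eq_integral => w _.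
  by rewrite /f /= max_l.
transitivity (\int[muX \x muE]_z f z)%E.
  by apply: eq_measure_integral => A mA _; apply/esym; exact: muE_prod.
rewrite fubini_tonelli1 //.
rewrite /fubini_F /=.
transitivity (\int[muX]_x ((Num.max x 0)%:E * \int[P]_w (g (eps i w))%:E))%E.
  apply: eq_integral => x _.
  rewrite /f /=.
  under eq_integral do rewrite EFinM.
  rewrite ge0_integralZl //.
  - by rewrite ge0_integral_distribution //; exact/measurable_EFinP.
  - exact/measurable_EFinP.
  - by move=> y _; rewrite lee_fin.
  - by rewrite lee_fin le_max lexx orbT.
rewrite ge0_integralZr //.
- congr (_ * _)%E; rewrite ge0_integral_distribution //.
  + by apply: eq_integral => w _ /=; rewrite max_l.
  + by apply/measurable_EFinP/measurable_maxr.
  + by move=> y; rewrite lee_fin le_max lexx orbT.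
- by apply/measurable_EFinP/measurable_maxr.
- by move=> x _; rewrite lee_fin le_max lexx orbT.
- by apply: integral_ge0 => w _; rewrite lee_fin.
Qed.

End Independence.

(** * Maximal inequality *)

Section Ville.
Context d (T : measurableType d) (R : realType) (P : probability T R) (n : nat).
Variable eps : 'I_n -> {RV P >-> R}.
Hypotheses (indep : mutually_independent eps) (subg : subgaussian eps).
Variables (f : nat -> 'I_n) (t u : R).

Definition factor (r : R) : R := expR (t * r - t ^+ 2 / 2).

Lemma measurable_factor : measurable_fun [set: R] factor.
Proof.
by apply: measurableT_comp => //; apply: measurable_funB => //.
Qed.

Lemma expectation_factor i : (\int[P]_w (factor (eps i w))%:E <= 1)%E.
Proof.
have := subg i t; rewrite /mmt_gen_fun unlock => H.
have -> : (\int[P]_w (factor (eps i w))%:E =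
   (expR (- (t ^+ 2 / 2)))%:E * \int[P]_w (expR (eps i w * t))%:E)%E.
  rewrite -ge0_integralZl //.
  - by apply: eq_integral => w _; rewrite -EFinM -expRD /factor mulrC addrC.
  - apply/measurable_EFinP; apply: measurableT_comp => //.
    exact: measurable_funM.
have -> : (1 = (expR (- (t ^+ 2 / 2)))%:E * (expR (t ^+ 2 / 2))%:E :> \bar R)%E.
  by rewrite -EFinM -expRD addNr expR0.
by apply: lee_wpmul2l; [rewrite lee_fin expR_ge0|exact: H].
Qed.

(* The supermartingale exp (t S_k - t ^ 2 k / 2), frozen once it reaches u. *)
Fixpoint stopped (k : nat) (w : T) : R :=
  if k is k'.+1 then
    if u <= stopped k' w then stopped k' w
    else stopped k' w * factor (eps (f k') w)
  else 1.

(** Splitting a value into its frozen part [above] and its running part [below] makes one step of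
    [stopped] affine in the fresh factor, so that independence applies to the running part alone. *)
Definition above (v : R) : R := if u <= v then v else 0.
Definition below (v : R) : R := if u <= v then 0 else v.

Lemma stoppedS k w :
  stopped k.+1 w =
  above (stopped k w) + below (stopped k w) * factor (eps (f k) w).
Proof.
by rewrite /= /above /below; case: ifP; rewrite ?mul0r ?add0r ?addr0.
Qed.

Lemma measurable_above : measurable_fun [set: R] above.
Proof.
apply: measurable_fun_ifT => //.
exact: measurable_fun_ler.
Qed.

Lemma measurable_below : measurable_fun [set: R] below.
Proof.
apply: measurable_fun_ifT => //.
exact: measurable_fun_ler.
Qed.

Lemma stopped_ge0 k w : 0 <= stopped k w.
Proof.
by elim: k => //= k IH; case: ifP => // _; rewrite mulr_ge0 ?expR_ge0.
Qed.

Definition past (k : nat) : {set 'I_n} := [set f i | i : 'I_k].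

Lemma measurable_stopped k :
  measurable_fun [set: g_sigma_algebraType (boxes eps (past k))] (stopped k).
Proof.
elim: k => [|k IH]; first exact: measurable_cst.
have IH' : measurable_fun
    [set: g_sigma_algebraType (boxes eps (past k.+1))] (stopped k).
  move=> _ A mA; have := IH measurableT A mA; rewrite !setTI.
  apply: sub_boxes; apply/fintype.subsetP => _ /imsetP[i _ ->].
  by apply/imsetP; exists (widen_ord (leqnSn k) i).
have -> : stopped k.+1 = (fun w => above (stopped k w) +
    below (stopped k w) * factor (eps (f k) w)).
  by apply/funext => w; rewrite stoppedS.
apply: measurable_funD.
  exact: (measurableT_comp measurable_above IH').
apply: measurable_funM; first exact: (measurableT_comp measurable_below IH').
apply: (measurableT_comp measurable_factor).
apply: measurable_fun_boxes; apply/imsetP.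
by exists ord_max.
Qed.

Lemma measurable_stoppedT k : measurable_fun [set: T] (stopped k).
Proof.
move=> _ A mA; apply: (@sigma_boxes_measurable _ _ _ _ _ eps (past k)).
exact: measurable_stopped.
Qed.

(** Supermartingale property: the fresh factor has expectation at most 1 and is independent of the
    past. Injectivity of [f] is what keeps the coordinate [f k] out of [past k]. *)
Lemma expectation_stopped N : {in gtn N &, injective f} ->
  (\int[P]_w (stopped N w)%:E <= 1)%E.
Proof.
elim: N => [|k IH] finj.
  by rewrite /= integral_cst //= mul1e probability_le1.
have mX : measurable_fun [set: T] (above \o stopped k).
  exact: (measurableT_comp measurable_above (@measurable_stoppedT k)).
have mY : measurable_fun [set: T] (below \o stopped k).
  exact: (measurableT_comp measurable_below (@measurable_stoppedT k)).
have X0 w : 0 <= above (stopped k w).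
  by rewrite /above; case: ifP => // _; exact: stopped_ge0.
have Y0 w : 0 <= below (stopped k w).
  by rewrite /below; case: ifP => // _; exact: stopped_ge0.
have mF : measurable_fun [set: T] (factor \o eps (f k)).
  exact: (measurableT_comp measurable_factor).
apply: (@le_trans _ _ (\int[P]_w (stopped k w)%:E)%E); last first.
  apply: IH => i j; rewrite !inE => ik jk; apply: finj;
    rewrite inE; exact: ltnW.
under eq_integral do rewrite stoppedS EFinD.
rewrite ge0_integralD //; last 4 first.
- by move=> w _; rewrite lee_fin.
- exact/measurable_EFinP.
- by move=> w _; rewrite lee_fin mulr_ge0 // expR_ge0.
- exact/measurable_EFinP/measurable_funM.
rewrite (@indep_expectation _ _ _ _ _ _ indep (past k)); last 5 first.
- apply/imsetP => -[i _ fki]; have := @finj k i; rewrite !inE ltnS leqnn.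
  move=> /(_ isT (ltnW (ltn_ord i)) fki) ki.
  by have := ltn_ord i; rewrite -ki ltnn.
- exact: (measurableT_comp measurable_below (@measurable_stopped k)).
- by [].
- exact: measurable_factor.
- by move=> r; exact: expR_ge0.
have -> : (\int[P]_w (stopped k w)%:E =
  \int[P]_w (above (stopped k w))%:E + \int[P]_w (below (stopped k w))%:E)%E.
  rewrite -ge0_integralD //.
  - apply: eq_integral => w _; rewrite -EFinD /above /below.
    by case: ifP; rewrite ?add0r ?addr0.
  - by move=> w _; rewrite lee_fin.
  - exact/measurable_EFinP.
  - by move=> w _; rewrite lee_fin.
  - exact/measurable_EFinP.
rewrite leeD2l // -[leRHS]mule1.
apply: lee_wpmul2l; last exact: expectation_factor.
by apply: integral_ge0 => w _; rewrite lee_fin.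
Qed.

(** Before the first crossing [stopped] coincides with the exponential process, and afterwards it
    stays put. The terminal value thus remembers every earlier crossing, and Markov's inequality at
    one time controls the whole path. *)
Lemma stopped_hit k h w : (h <= k)%N ->
  u <= expR (t * (\sum_(0 <= i < h) eps (f i) w) - t ^+ 2 / 2 *+ h) ->
  u <= stopped k w.
Proof.
have stay m : u <= stopped m w -> u <= stopped m.+1 w.
  by move=> um /=; rewrite um.
have run m : stopped m w =
      expR (t * (\sum_(0 <= i < m) eps (f i) w) - t ^+ 2 / 2 *+ m) \/
    u <= stopped m w.
  elim: m => [|m [IH|IH]].
    by left; rewrite big_nil /= mulr0 mulr0n subr0 expR0.
    case: (leP u (stopped m w)) => um; [by right; exact: stay|left].
    rewrite /= leNgt um /= IH -expRD big_nat_recr //=; congr expR.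
    by rewrite mulrSr; ring.
  by right; exact: stay.
elim: k => [|k IH]; first by rewrite leqn0 => /eqP->; have [->|] := run 0%N.
rewrite leq_eqVlt ltnS => /orP[/eqP-> H|hk H]; last exact/stay/IH.
by have [->|] := run k.+1.
Qed.

End Ville.

(** If t S_h >= t^2 h with h >= h0, then t S_h - t^2 h / 2 >= t^2 h0 / 2, so the exponential process
    has reached [u]. Markov's inequality bounds the probability of this by 1 / u. *)
Lemma subgaussian_maximal d (T : measurableType d) (R : realType)
  (P : probability T R) (n : nat) (eps : 'I_n -> {RV P >-> R})
  (f : nat -> 'I_n) (N : nat) (t h0 : R) :
  mutually_independent eps -> subgaussian eps -> {in gtn N &, injective f} ->
  exists2 E : set T,
    measurable E /\ (P E <= (expR (- (t ^+ 2 / 2 * h0)))%:E)%E &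
  forall w (h : nat), (h <= N)%N -> h0 <= h%:R ->
    t ^+ 2 *+ h <= t * \sum_(0 <= i < h) eps (f i) w -> E w.
Proof.
move=> indep subg finj.
pose u := expR (t ^+ 2 / 2 * h0).
pose W := stopped eps f t u N.
have mW : measurable_fun [set: T] W by exact: measurable_stoppedT.
exists [set w | u <= W w]; last first.
  move=> w h hN h0h H /=; apply: (stopped_hit hN).
  rewrite ler_expR -mulr_natr; move: H; rewrite -mulr_natr => H.
  have : t ^+ 2 / 2 * h0 <= t ^+ 2 / 2 * h%:R.
    by rewrite ler_wpM2l // divr_ge0 // sqr_ge0.
  by move: H; set a := t * _; set b := t ^+ 2; lra.
have u0 : 0 < u by exact: expR_gt0.
split.
  rewrite -[X in measurable X]setTI.
  by apply: measurable_fun_le.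
pose X : {RV P >-> R} := HB.pack W (isMeasurableFun.Build _ _ _ _ W mW).
have := @markov _ _ _ P X id u u0 (@measurable_id _ _ _) (fun r r0 => r0)
  (fun _ _ _ _ => id).
rewrite unlock /= => M.
rewrite expRN -[leRHS]mule1 lee_pdivlMl //.
apply: le_trans (expectation_stopped indep subg t u finj).
have -> : [set w | u <= W w] = [set x | (u%:E <= `|W x|%:E)%E].
  by apply/seteqP; split => w /=; rewrite lee_fin ger0_norm // stopped_ge0.
apply: (le_trans M).
rewrite le_eqVlt; apply/orP; left; apply/eqP/eq_integral => w _ /=.
by rewrite ger0_norm // stopped_ge0.
Qed.

(** * Segment sums and least squares *)

Section SegmentSum.
Variables (R : realType) (n : nat).
Implicit Types (y : 'I_n -> R) (s e : nat).

Definition segment_sum y s e : R := \sum_(i < n | (s <= i.+1 < e)%N) y i.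

Lemma segment_meanE y s e : segment_mean y s e = segment_sum y s e / (e - s)%:R.
Proof. by []. Qed.

Lemma segment_sum_cat m y s e : (s <= m <= e)%N ->
  segment_sum y s e = segment_sum y s m + segment_sum y m e.
Proof.
move=> /andP[sm me].
rewrite /segment_sum (bigID (fun i : 'I_n => (i.+1 < m)%N)) /=.
by congr (_ + _); apply: eq_bigl => i; lia.
Qed.

Lemma segment_sum0 y s : segment_sum y s s = 0.
Proof. by rewrite /segment_sum big_pred0 // => i; lia. Qed.

Lemma segment_sum1 y (i : 'I_n) s : s = i.+1 -> segment_sum y s s.+1 = y i.
Proof.
move=> ->; rewrite /segment_sum (big_pred1 i) // => j.
by apply/idP/eqP => [H|->]; [apply/val_inj => /=; lia|lia].
Qed.

Lemma segment_sumD y y' s e :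
  segment_sum (fun i => y i + y' i) s e =
  segment_sum y s e + segment_sum y' s e.
Proof. exact: big_split. Qed.

Lemma segment_sum_const y s e c : (1 <= s <= e)%N -> (e <= n.+1)%N ->
  (forall i : 'I_n, (s <= i.+1 < e)%N -> y i = c) ->
  segment_sum y s e = (e - s)%:R * c.
Proof.
move=> /andP[s1]; elim: e => [|e IH]; first by lia.
rewrite leq_eqVlt => /orP[/eqP->|se] en yc.
  by rewrite segment_sum0 subnn mul0r.
have en' : (e.-1 < n)%N by lia.
rewrite (@segment_sum_cat e); last by lia.
rewrite IH; [|lia|lia|by move=> i Hi; apply: yc; lia].
rewrite (@segment_sum1 _ (Ordinal en')) /=; last by lia.
rewrite yc /=; last by lia.
by rewrite subSn; [rewrite -natr1 mulrDl mul1r|lia].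
Qed.

Lemma cusumD y y' t : cusum (fun i => y i + y' i) t = cusum y t + cusum y' t.
Proof.
case: t => [[t1 t2] t3]; rewrite /cusum !segment_meanE !segment_sumD; ring.
Qed.

End SegmentSum.

Lemma dotBl (R : realType) (I : finType) (u v w : {ffun I -> R}) :
  dot (u - v) w = dot u w - dot v w.
Proof.
by rewrite /dot -sumrB; apply: eq_bigr => i _; rewrite !ffunE mulrBl.
Qed.

Lemma dotC (R : realType) (I : finType) (u v : {ffun I -> R}) :
  dot u v = dot v u.
Proof. by apply: eq_bigr => i _; rewrite mulrC. Qed.

Lemma dot_eq0 (R : realType) (I : finType) (u : {ffun I -> R}) :
  dot u u = 0 -> u = 0.
Proof.
move=> /psumr_eq0P H; apply/ffunP => i; rewrite ffunE; apply/eqP.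
by rewrite -sqrf_eq0 expr2; apply/eqP/H => // j _; rewrite -expr2 sqr_ge0.
Qed.

(** Two candidates differ by an element of V that is orthogonal to itself, hence zero. *)
Lemma orth_projE (R : realType) (I : finType) (V : set {ffun I -> R})
    (u p : {ffun I -> R}) :
  (forall v w, V v -> V w -> V (v - w)) ->
  V p -> (forall v, V v -> dot (u - p) v = 0) -> orth_proj V u = p.
Proof.
move=> VB Vp up; rewrite /orth_proj.
case: xgetP => [q _ [Vq uq]|/(_ p)]; last by case.
apply/eqP; rewrite -subr_eq0; apply/eqP/dot_eq0.
have Vqp := VB _ _ Vq Vp; have := up _ Vqp; have := uq _ Vqp.
rewrite !dotBl; lra.
Qed.

Section LeastSquares.
Variables (R : realType) (n : nat) (y : 'I_n -> R) (a l b : nat).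
Hypotheses (a1 : (1 <= a)%N) (al : (a < l)%N) (lb : (l < b)%N)
  (bn : (b <= n.+1)%N).

Lemma sum_window (F : 'I_n -> R) :
  \sum_(i : window n a b) F (val i) = \sum_(i < n | (a <= i.+1 < b)%N) F i.
Proof.
rewrite [RHS](reindex_omap (val : window n a b -> 'I_n) insub) => [|i Hi].
  by apply: eq_bigl => i; rewrite valK eqxx andbT; apply/esym/(valP i).
by rewrite insubT.
Qed.

Lemma sum_window2 (F : 'I_n -> R) (c c' : R) :
  \sum_(i : window n a b) F (val i) * (if ((val i).+1 < l)%N then c else c') =
  segment_sum F a l * c + segment_sum F l b * c'.
Proof.
rewrite (sum_window (fun i => F i * if (i.+1 < l)%N then c else c')).
rewrite (bigID (fun i : 'I_n => (i.+1 < l)%N)) /= /segment_sum !mulr_suml.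
congr (_ + _); apply: eq_big => i; try lia.
  by move=> /andP[_ ->].
by move=> /andP[_ /negbTE->].
Qed.

(** The projection replaces each block by its mean; Pythagoras gives the total minus the explained
    sum of squares. The total does not depend on the split, so it cancels when two splits are
    compared. *)
Lemma ls_criterionE : ls_criterion y a b l =
  \sum_(i < n | (a <= i.+1 < b)%N) y i ^+ 2 -
  (segment_sum y a l ^+ 2 / (l - a)%:R + segment_sum y l b ^+ 2 / (b - l)%:R).
Proof.
pose m1 := segment_mean y a l; pose m2 := segment_mean y l b.
pose p : {ffun window n a b -> R} :=
  [ffun i : window n a b => if ((val i).+1 < l)%N then m1 else m2].
have la0 : (l - a)%:R != 0 :> R by rewrite pnatr_eq0; lia.
have bl0 : (b - l)%:R != 0 :> R by rewrite pnatr_eq0; lia.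
have yl1 : segment_sum y a l = (l - a)%:R * m1.
  by rewrite /m1 segment_meanE mulrC divfK.
have yl2 : segment_sum y l b = (b - l)%:R * m2.
  by rewrite /m2 segment_meanE mulrC divfK.
have Vp : @two_piece R n a l b p by move=> i j; rewrite !ffunE => ->.
have an : (a.-1 < n)%N by lia.
have ln : (l.-1 < n)%N by lia.
have iaP : (a <= (Ordinal an).+1 < b)%N by rewrite /=; lia.
have ilP : (a <= (Ordinal ln).+1 < b)%N by rewrite /=; lia.
(* The first index of each block (the ordinals [a.-1] and [l.-1] stand for the positions a and l)
   determines a two-piece vector. *)
pose ia : window n a b := Sub (Ordinal an) iaP.
pose il : window n a b := Sub (Ordinal ln) ilP.
have VE (v : {ffun window n a b -> R}) : @two_piece R n a l b v ->
    forall i, v i = if ((val i).+1 < l)%N then v ia else v il.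
  move=> Vv i; case: ifP => H; apply: Vv; rewrite H /=; lia.
have up v : @two_piece R n a l b v -> dot (Defs.restrict y a b - p) v = 0.
  move=> /VE vE; rewrite dotBl /dot.
  under eq_bigr do rewrite ffunE vE.
  rewrite sum_window2.
  have -> : \sum_i p i * v i = \sum_(i : window n a b) 1 *
      (if ((val i).+1 < l)%N then m1 * v ia else m2 * v il).
    by apply: eq_bigr => i _; rewrite vE ffunE mul1r; case: ifP.
  rewrite (sum_window2 (fun=> 1)) yl1 yl2.
  rewrite !(@segment_sum_const _ _ _ _ _ 1) //; try lia.
  by ring.
have VB v w : @two_piece R n a l b v -> @two_piece R n a l b w ->
    @two_piece R n a l b (v - w).
  by move=> Vv Vw i j ij; rewrite !ffunE (Vv i j) // (Vw i j).
rewrite /ls_criterion (orth_projE VB Vp up).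
set u := Defs.restrict y a b.
have -> : dot (u - p) (u - p) = dot u u - dot u p.
  have := up _ Vp; rewrite dotC !dotBl [dot u (u - p)]dotC [dot p (u - p)]dotC.
  by rewrite !dotBl [dot p u]dotC => ->; rewrite subr0.
congr (_ - _).
  rewrite /dot /u; under eq_bigr do rewrite ffunE.
  by rewrite (sum_window (fun i => y i * y i)).
rewrite /dot /u; under eq_bigr do rewrite !ffunE.
rewrite sum_window2 yl1 yl2; field.
by rewrite la0 bl0.
Qed.

End LeastSquares.

(** As j <= 2p, p / (p + j) >= 1/3, so the gain is at least 27/100 j D^2; as q / (j + q) <= 1, the
    loss is at most 9/100 j D^2. *)
Lemma better_split (R : realType) (p j q SA SJ SB D : R) :
  0 < p -> 0 < j -> 0 < q -> j <= 2 * p -> D != 0 ->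
  9 / 10 * `|D| <= `|SA / p - SJ / j| -> `|SJ / j - SB / q| <= 3 / 10 * `|D| ->
  (SA + SJ) ^+ 2 / (p + j) + SB ^+ 2 / q <
  SA ^+ 2 / p + (SJ + SB) ^+ 2 / (j + q).
Proof.
move=> p0 j0 q0 jp D0 H1 H2.
have D1 : 0 <= `|D| by [].
have D2 : 0 < D ^+ 2 by rewrite lt_def sqr_ge0 sqrf_eq0 D0.
rewrite -subr_gt0.
have -> : SA ^+ 2 / p + (SJ + SB) ^+ 2 / (j + q) -
  ((SA + SJ) ^+ 2 / (p + j) + SB ^+ 2 / q) =
  p / (p + j) * j * (SA / p - SJ / j) ^+ 2 -
  q / (j + q) * j * (SJ / j - SB / q) ^+ 2.
  field; rewrite !gt_eqF ?addr_gt0 //.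
have X1 : 81 / 100 * D ^+ 2 <= (SA / p - SJ / j) ^+ 2.
  have : (9 / 10 * `|D|) ^+ 2 <= `|SA / p - SJ / j| ^+ 2.
    by rewrite lerXn2r ?nnegrE ?mulr_ge0 //; lra.
  by rewrite !real_normK ?num_real // exprMn real_normK ?num_real //; lra.
have X2 : (SJ / j - SB / q) ^+ 2 <= 9 / 100 * D ^+ 2.
  have : `|SJ / j - SB / q| ^+ 2 <= (3 / 10 * `|D|) ^+ 2.
    by rewrite lerXn2r ?nnegrE ?mulr_ge0 //; lra.
  by rewrite !real_normK ?num_real // exprMn real_normK ?num_real //; lra.
have Y1 : 1 / 3 <= p / (p + j) by rewrite ler_pdivlMr ?addr_gt0 //; lra.
have Y2 : q / (j + q) <= 1 by rewrite ler_pdivrMr ?addr_gt0 //; lra.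
rewrite subr_gt0.
apply: (@le_lt_trans _ _ (j * (9 / 100 * D ^+ 2))).
  rewrite -mulrA -[leRHS]mul1r ler_pM //.
  - by rewrite divr_ge0 ?addr_ge0 // ltW.
  - by rewrite mulr_ge0 ?sqr_ge0 // ltW.
  - by rewrite ler_pM2l.
apply: (@lt_le_trans _ _ (1 / 3 * (j * (81 / 100 * D ^+ 2)))).
  have jD : 0 < j * D ^+ 2 by rewrite mulr_gt0.
  lra.
rewrite -[leRHS]mulrA; apply: ler_pM => //.
- by apply: mulr_ge0; [exact: ltW|apply: mulr_ge0; [lra|exact: sqr_ge0]].
- by rewrite ler_pM2l.
Qed.

(** * Detection and localization on the good event *)

Section Detection.
Variables (R : realType) (n p0 s p1 : nat).
Hypotheses (p0_ge1 : (1 <= p0)%N) (p0s : (p0 < s)%N) (sp1 : (s < p1)%N)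
  (p1n : (p1 <= n.+1)%N).
Let m := minn (s - p0) (p1 - s).

Lemma scale_le_min : scale R (p0, s, p1) <= Num.sqrt m%:R.
Proof.
rewrite ler_sqrt ?ler0n // ler_pdivrMr ?ltr0n; last by lia.
rewrite -!natrM ler_nat /m (_ : (p1 - p0 = s - p0 + (p1 - s))%N); last by lia.
by move: (s - p0)%N (p1 - s)%N => a b; case: leqP => ab; nia.
Qed.

(** With rho the argument of the logarithm at (p0, s, p1), the symmetric window has argument 2n / r
    <= 16/3 rho, because AB / (A + B) <= m <= 8r/3. Moreover n >= A + B gives rho >= 4, so 16/3 <=
    rho^2, and the argument is at most rho^3. *)
Lemma penalty_window t r : (0 < r)%N -> (3 * m <= 8 * r)%N -> (r <= t)%N ->
  0 <= penalty R n (p0, s, p1) /\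
  penalty R n (t - r, t, t + r)%N <= 3 * penalty R n (p0, s, p1).
Proof.
move=> r0 mr rt; rewrite /penalty.
have -> : (t + r - (t - r) = r + r)%N by lia.
have -> : (t + r - t = r)%N by lia.
have -> : (t - (t - r) = r)%N by lia.
have -> : (p1 - p0 = (s - p0) + (p1 - s))%N by lia.
have nAB : (s - p0 + (p1 - s) <= n)%N by lia.
have A0 : (0 < s - p0)%N by lia.
have B0 : (0 < p1 - s)%N by lia.
move: mr nAB A0 B0; rewrite /m; move: (s - p0)%N (p1 - s)%N => a b mr nab a0 b0.
rewrite !natrD.
set A : R := a%:R; set B : R := b%:R; set N : R := n%:R; set r' : R := r%:R.
have A0 : 0 < A by rewrite ltr0n.
have B0 : 0 < B by rewrite ltr0n.
have r'0 : 0 < r' by rewrite ltr0n.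
have NAB : A + B <= N by rewrite -natrD ler_nat.
have N0 : 0 < N by lra.
set rho := N * (A + B) / (B * A).
have rho0 : 0 < rho by rewrite divr_gt0 ?mulr_gt0 // addr_gt0.
have rho4 : 4 <= rho.
  rewrite ler_pdivlMr ?mulr_gt0 //.
  have h1 : (A + B) * (A + B) <= N * (A + B) by rewrite ler_pM2r // addr_gt0.
  have h2 : 0 <= (A - B) ^+ 2 by exact: sqr_ge0.
  by apply: le_trans h1; rewrite -subr_ge0; move: h2; congr (_ <= _); ring.
have rhor : N * (r' + r') / (r' * r') <= 16 / 3 * rho.
  have -> : N * (r' + r') / (r' * r') = 2 * N / r' by field; rewrite gt_eqF.
  rewrite ler_pdivrMr //.
  have : 3 * A * B <= 8 * r' * (A + B).
    rewrite -!(natrM _ 3) -!(natrM _ 8) -natrD -!natrM ler_nat.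
    by move: mr; case: leqP => ab; nia.
  rewrite /rho => h.
  have -> : 16 / 3 * (N * (A + B) / (B * A)) * r' =
     2 * N * ((8 * r' * (A + B)) / (3 * A * B)) by field; rewrite !gt_eqF.
  rewrite ler_peMr ?mulr_ge0 ?(ltW N0) //.
  by rewrite ler_pdivlMr ?mul1r // !mulr_gt0.
have lnrho : 0 <= ln rho by rewrite ln_ge0 //; lra.
split; first by rewrite mulr_ge0.
have -> : 3 * (2 * ln rho) = 2 * ln (rho ^+ 3).
  by rewrite lnXn // -mulr_natr; ring.
rewrite ler_pM2l // ler_ln ?posrE ?exprn_gt0 //; last first.
  by rewrite divr_gt0 ?mulr_gt0 ?addr_gt0.
apply: (le_trans rhor).
rewrite exprSr ler_pM2r //.
have : 4 ^+ 2 <= rho ^+ 2 by rewrite lerXn2r ?nnegrE // ltW.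
lra.
Qed.

Variables (theta e : 'I_n -> R) (zeta mu0 mu1 : R).
Hypotheses (theta0 : forall i : 'I_n, (p0 <= i.+1 < s)%N -> theta i = mu0)
  (theta1 : forall i : 'I_n, (s <= i.+1 < p1)%N -> theta i = mu1).
Let D := mu1 - mu0.
Hypothesis energy : 100 * Num.sqrt (penalty R n (p0, s, p1) + zeta ^+ 2) <
   `|D| * scale R (p0, s, p1).
Hypothesis good : forall t, T3 n t -> `|cusum e t| <= lambda R n t + zeta.
Variable tau : nat.
Let y i := theta i + e i.

Lemma segment_sum_theta0 a b : (p0 <= a <= b)%N -> (b <= s)%N ->
  segment_sum theta a b = (b - a)%:R * mu0.
Proof.
move=> ab bs; apply: segment_sum_const; try lia.
by move=> i Hi; apply: theta0; lia.
Qed.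

Lemma segment_sum_theta1 a b : (s <= a <= b)%N -> (b <= p1)%N ->
  segment_sum theta a b = (b - a)%:R * mu1.
Proof.
move=> ab bs; apply: segment_sum_const; try lia.
by move=> i Hi; apply: theta1; lia.
Qed.

Lemma cusum_theta_far t1 t2 t3 : (t1 < t2 < t3)%N ->
  (p0 <= t1)%N -> (t3 <= p1)%N -> (t3 <= s)%N || (s <= t1)%N ->
  cusum theta (t1, t2, t3) = 0.
Proof.
move=> t123 pt tp; rewrite /cusum !segment_meanE => /orP[ts|st].
  rewrite !segment_sum_theta0; try lia.
  rewrite ![_%:R * mu0]mulrC !mulfK ?subrr ?mul0r // pnatr_eq0; lia.
rewrite !segment_sum_theta1; try lia.
rewrite ![_%:R * mu1]mulrC !mulfK ?subrr ?mul0r // pnatr_eq0; lia.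
Qed.

(** With truncated subtraction, [(tau - s) + (s - tau)] is the distance |tau - s|. The misplaced
    stretch contaminates one of the two means, which shrinks the signal linearly in this
    distance. *)
Lemma cusum_theta_near r : (tau - s < r)%N -> (s - tau < r)%N ->
  (p0 + r <= tau)%N -> (tau + r <= p1)%N ->
  cusum theta (tau - r, tau, tau + r)%N =
  D * ((r - ((tau - s) + (s - tau)))%:R / r%:R) *
  scale R (tau - r, tau, tau + r)%N.
Proof.
move=> r1 r2 r3 r4; rewrite /cusum; congr (_ * _).
have r0 : r%:R != 0 :> R by rewrite pnatr_eq0; lia.
rewrite !segment_meanE.
have -> : (tau + r - tau = r)%N by lia.
have -> : (tau - (tau - r) = r)%N by lia.
case: (leqP tau s) => ts.
  rewrite (@segment_sum_cat _ _ s _ tau); last by lia.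
  rewrite segment_sum_theta0; try lia.
  rewrite segment_sum_theta1; try lia.
  rewrite segment_sum_theta0; try lia.
  have -> : (tau - s = 0)%N by lia.
  have -> : (tau + r - s = r - (s - tau))%N by lia.
  have -> : (tau - (tau - r) = r)%N by lia.
  by rewrite add0n /D [(r - (s - tau))%:R]natrB; [field|lia].
rewrite (@segment_sum_cat _ _ s _ (tau - r)); last by lia.
rewrite segment_sum_theta1; try lia.
rewrite segment_sum_theta0; try lia.
rewrite segment_sum_theta1; try lia.
have -> : (s - tau = 0)%N by lia.
have -> : (tau + r - tau = r)%N by lia.
have -> : (s - (tau - r) = r - (tau - s))%N by lia.
by rewrite addn0 /D [(r - (tau - s))%:R]natrB; [field|lia].
Qed.

(** Let Q be the square root in [energy]. The threshold is at most 3Q (2Q for lambda, Q for zeta),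
    and so is the noise. Misalignment and the smaller window cost a factor 1/3 each, leaving a
    signal above 100/9 Q > 6Q. *)
Lemma detects_near r : (0 < r)%N -> (3 * m <= 8 * r)%N ->
  (3 * ((tau - s) + (s - tau)) <= 2 * r)%N ->
  (p0 + r <= tau)%N -> (tau + r <= p1)%N -> detects y zeta tau r.
Proof.
move=> r_gt0 mr dr lo hi; apply/andP; split; first exact: r_gt0.
have rtau : (r <= tau)%N by lia.
have sums : [/\ maxn (tau - r) 1 = (tau - r)%N,
    minn (tau + r) n.+1 = (tau + r)%N,
    (tau + r - (tau - r) = r + r)%N, (tau + r - tau = r)%N &
    (tau - (tau - r) = r)%N].
  by split; lia.
have [max_r min_r sum1 sum2 sum3] := sums; clear sums.
rewrite /sym_triplet max_r min_r /y cusumD.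
set t := (_, _, _).
have tT : T3 n t by rewrite /T3 /t /=; lia.
have H := good tT.
have [pen0 penle] : 0 <= penalty R n (p0, s, p1) /\
    penalty R n t <= 3 * penalty R n (p0, s, p1).
  by exact: penalty_window.
have en := energy; set Q := Num.sqrt _ in en.
have Q0 : 0 <= Q by exact: sqrtr_ge0.
have Q2 : Q ^+ 2 = penalty R n (p0, s, p1) + zeta ^+ 2.
  by rewrite sqr_sqrtr // addr_ge0 // sqr_ge0.
have lamQ : lambda R n t <= 2 * Q.
  rewrite /lambda -[leRHS]ger0_norm; last lra.
  rewrite -sqrtr_sqr ler_sqrt ?sqr_ge0 // exprMn Q2.
  by have := sqr_ge0 zeta; lra.
have zetaQ : zeta <= Q.
  apply: (le_trans (ler_norm _)); rewrite -sqrtr_sqr ler_sqrt; last first.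
    by rewrite addr_ge0 // sqr_ge0.
  by rewrite lerDr.
have scale_t : 1 / 3 * Num.sqrt m%:R <= scale R t.
  rewrite /scale /t.
  rewrite sum1 sum2 sum3 -[1 / 3]ger0_norm; last lra.
  rewrite -sqrtr_sqr -sqrtrM ?sqr_ge0 // ler_sqrt; last first.
    by rewrite divr_ge0 // mulr_ge0.
  rewrite natrD ler_pdivlMr; last by rewrite addr_gt0 ?ltr0n.
  have : m%:R <= 3 * r%:R :> R.
    by rewrite -natrM ler_nat; move: mr dr r_gt0; clear; lia.
  have r0R : 0 <= r%:R :> R by [].
  by move=> mR; have := ler_wpM2r r0R mR; have := mulr_ge0 r0R r0R; lra.
have frac : 1 / 3 <= (r - (tau - s + (s - tau)))%:R / r%:R :> R.
  rewrite ler_pdivlMr ?ltr0n //.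
  have : r%:R <= 3 * (r - (tau - s + (s - tau)))%:R :> R.
    by rewrite -natrM ler_nat; move: mr dr r_gt0; clear; lia.
  lra.
have signal : 1 / 9 * (`|D| * scale R (p0, s, p1)) <= `|cusum theta t|.
  have [d1 d2] : (tau - s < r)%N /\ (s - tau < r)%N.
    by move: dr r_gt0; clear; lia.
  rewrite cusum_theta_near //.
  rewrite 2!normrM -[leRHS]mulrA (ger0_norm (le_trans _ frac)); last lra.
  rewrite (ger0_norm (sqrtr_ge0 _)).
  have -> : 1 / 9 * (`|D| * scale R (p0, s, p1)) =
    `|D| * (1 / 3 * (1 / 3 * scale R (p0, s, p1))) by field.
  apply: ler_wpM2l => //; apply: ler_pM => //; try lra.
    by rewrite mulr_ge0 ?sqrtr_ge0 //; lra.
  apply: le_trans scale_t; apply: ler_wpM2l; first lra.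
  exact: scale_le_min.
have := lerB_normD (cusum theta t) (cusum e t).
lra.
Qed.

Hypotheses (tau_lo : (4 * (tau - s) < m)%N) (tau_hi : (4 * (s - tau) < m)%N).

Lemma radius_detected : exists r, [/\ Defs.radius y zeta tau = Some r,
  (0 < r)%N, (tau - s < r)%N /\ (s - tau < r)%N,
  (p0 + (2 * r - 1) <= tau)%N & (tau + (2 * r - 1) <= p1)%N].
Proof.
have [r0 [r0_gt0 mr0 dr0 lo0 hi0]] : exists r0, [/\ (0 < r0)%N,
    (3 * m <= 8 * r0)%N, (3 * ((tau - s) + (s - tau)) <= 2 * r0)%N,
    (p0 + (2 * r0 - 1) <= tau)%N &
    (tau + (2 * r0 - 1) <= p1)%N].
  (* The largest radius with 2 r0 - 1 <= m - |tau - s|, which keeps the outer window inside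
     [p0, p1]. As 4 |tau - s| < m, it is still at least 3m/8. *)
  exists (m - ((tau - s) + (s - tau))).+1./2.
  have mA : (m <= s - p0)%N by exact: geq_minl.
  have mB : (m <= p1 - s)%N by exact: geq_minr.
  move: m tau_lo tau_hi mA mB p0s sp1 => m' h1 h2 h3 h4 h5 h6.
  by split; lia.
have det0 : detects y zeta tau r0 by apply: detects_near => //; lia.
rewrite /Defs.radius; case: pselect => [ex_r|]; last by case; exists r0.
exists (ex_minn ex_r); case: ex_minnP => r rP /(_ _ det0) rr0.
have r_gt0 : (0 < r)%N by case/andP: rP.
have lo : (p0 + (2 * r - 1) <= tau)%N by lia.
have hi : (tau + (2 * r - 1) <= p1)%N by lia.
suff : ((tau - s < r) && (s - tau < r))%N by move/andP.
(* If the window does not straddle s, the mean is constant on it and the CUSUM is pure noise, below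
   the threshold on the good event. *)
apply/negPn/negP => far; move/andP: rP => [_]; apply/negP; rewrite -leNgt.
rewrite /y cusumD /sym_triplet.
have -> : maxn (tau - r) 1 = (tau - r)%N by lia.
have -> : minn (tau + r) n.+1 = (tau + r)%N by lia.
rewrite cusum_theta_far; try lia.
by rewrite add0r; apply: good; rewrite /T3 /=; lia.
Qed.

End Detection.

(** Block B does not start at the change-point, so only eJ + eB is controlled. By difference |eB| <=
    |D| / 20 (2j + q) <= |D| / 4 q, using j <= 2q. This gives the constants 1 - 2/20 = 9/10 and 1/20
    + 1/4 = 3/10 of [better_split]. *)
Lemma better_split_noise (R : realType) (p j q mu mu' eA eJ eB : R) :
  0 < p -> 0 < j -> 0 < q -> j <= 2 * p -> j <= 2 * q -> mu' - mu != 0 ->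
  `|eA| <= `|mu' - mu| / 20 * p -> `|eJ| <= `|mu' - mu| / 20 * j ->
  `|eJ + eB| <= `|mu' - mu| / 20 * (j + q) ->
  (p * mu + eA + (j * mu' + eJ)) ^+ 2 / (p + j) + (q * mu' + eB) ^+ 2 / q <
  (p * mu + eA) ^+ 2 / p + (j * mu' + eJ + (q * mu' + eB)) ^+ 2 / (j + q).
Proof.
set D := mu' - mu => p0 j0 q0 jp jq D0 HA HJ HJB.
have [pn [jn qn]] : p != 0 /\ j != 0 /\ q != 0 by rewrite !gt_eqF.
have D1 : 0 <= `|D| by [].
have HA' : `|eA / p| <= `|D| / 20.
  by rewrite normrM normfV (gtr0_norm p0) ler_pdivrMr.
have HJ' : `|eJ / j| <= `|D| / 20.
  by rewrite normrM normfV (gtr0_norm j0) ler_pdivrMr.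
have HB' : `|eB / q| <= `|D| / 4.
  rewrite normrM normfV (gtr0_norm q0) ler_pdivrMr //.
  have : `|eB| <= `|eJ + eB| + `|eJ|.
    rewrite -[eB in leLHS](addKr eJ) addrC.
    by rewrite (le_trans (ler_normD _ _)) // normrN.
  have := ler_wpM2l D1 jq; lra.
apply: (@better_split _ _ _ _ _ _ _ D) => //.
  have -> : (p * mu + eA) / p - (j * mu' + eJ) / j = - (D - (eA / p - eJ / j)).
    by rewrite /D; field; rewrite pn jn.
  rewrite normrN; have := lerB_dist D (eA / p - eJ / j).
  have := ler_normB (eA / p) (eJ / j); lra.
have -> : (j * mu' + eJ) / j - (q * mu' + eB) / q = eJ / j - eB / q.
  by field; rewrite qn jn.
have := ler_normB (eJ / j) (eB / q); lra.
Qed.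

Section Localization.
Variables (R : realType) (n p0 s p1 : nat).
Hypotheses (p0_ge1 : (1 <= p0)%N) (p0s : (p0 < s)%N) (sp1 : (s < p1)%N)
  (p1n : (p1 <= n.+1)%N).
Variables (theta e : 'I_n -> R) (zeta mu0 mu1 : R).
Hypotheses (theta0 : forall i : 'I_n, (p0 <= i.+1 < s)%N -> theta i = mu0)
  (theta1 : forall i : 'I_n, (s <= i.+1 < p1)%N -> theta i = mu1).
Let D := mu1 - mu0.
Hypotheses (D0 : D != 0).
Variable h0 : R.
Hypothesis h0_gt0 : 0 < h0.
Hypothesis noise_right : forall h, (s + h <= n.+1)%N -> h0 <= h%:R ->
  `|segment_sum e s (s + h)| <= `|D| / 20 * h%:R.
Hypothesis noise_left : forall h, (h < s)%N -> h0 <= h%:R ->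
  `|segment_sum e (s - h) s| <= `|D| / 20 * h%:R.
Let y i := theta i + e i.

Lemma segment_sum_y0 a b : (p0 <= a <= b)%N -> (b <= s)%N ->
  segment_sum y a b = (b - a)%:R * mu0 + segment_sum e a b.
Proof.
move=> ab bs.
rewrite segment_sumD (@segment_sum_const _ _ theta a b mu0) //; try lia.
by move=> i Hi; apply: theta0; lia.
Qed.

Lemma segment_sum_y1 a b : (s <= a <= b)%N -> (b <= p1)%N ->
  segment_sum y a b = (b - a)%:R * mu1 + segment_sum e a b.
Proof.
move=> ab bs.
rewrite segment_sumD (@segment_sum_const _ _ theta a b mu1) //; try lia.
by move=> i Hi; apply: theta1; lia.
Qed.

(** A displacement of at least 2 h0 is required because the block [a, s) may be only half as long,
    and its length must still be at least h0 for [noise_left] to apply. *)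
Lemma ls_criterion_lt_right a b l : (p0 <= a)%N -> (b <= p1)%N ->
  (a < s)%N -> (s < l)%N -> (l < b)%N ->
  (l - s <= 2 * (s - a))%N -> (l - s <= 2 * (b - l))%N ->
  2 * h0 <= (l - s)%:R ->
  ls_criterion y a b s < ls_criterion y a b l.
Proof.
move=> pa bp as_ sl lb ja jb h0j.
have h00 := h0_gt0.
rewrite !ls_criterionE; try lia.
rewrite ltrD2l ltrN2.
rewrite (@segment_sum_cat _ _ s y a l); last lia.
rewrite (@segment_sum_cat _ _ l y s b); last lia.
rewrite segment_sum_y0; try lia.
rewrite !segment_sum_y1; try lia.
have -> : (l - a = (s - a) + (l - s))%N by lia.
have -> : (b - s = (l - s) + (b - l))%N by lia.
have jaR : (l - s)%:R <= 2 * (s - a)%:R :> R by rewrite -natrM ler_nat.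
have jbR : (l - s)%:R <= 2 * (b - l)%:R :> R by rewrite -natrM ler_nat.
have bl0 : 0 <= (b - l)%:R :> R by [].
rewrite !natrD; apply: better_split_noise => //; rewrite ?ltr0n ?subn_gt0 //.
- have := @noise_left (s - a).
  rewrite (_ : s - (s - a) = a)%N; last lia.
  by apply; [lia|lra].
- have := @noise_right (l - s).
  rewrite (_ : s + (l - s) = l)%N; last lia.
  by apply; [lia|lra].
- rewrite -segment_sum_cat; last lia.
  have := @noise_right (b - s).
  rewrite (_ : s + (b - s) = b)%N; last lia.
  rewrite (_ : b - s = (l - s) + (b - l))%N; last lia.
  rewrite natrD; apply; [lia|lra].
Qed.

Lemma ls_criterion_lt_left a b l : (p0 <= a)%N -> (b <= p1)%N ->
  (a < l)%N -> (l < s)%N -> (s < b)%N ->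
  (s - l <= 2 * (b - s))%N -> (s - l <= 2 * (l - a))%N ->
  2 * h0 <= (s - l)%:R ->
  ls_criterion y a b s < ls_criterion y a b l.
Proof.
move=> pa bp al ls sb jb ja h0j.
have h00 := h0_gt0.
rewrite !ls_criterionE; try lia.
rewrite ltrD2l ltrN2.
rewrite (@segment_sum_cat _ _ l y a s); last lia.
rewrite (@segment_sum_cat _ _ s y l b); last lia.
rewrite (@segment_sum_y0 a l) 1?(@segment_sum_y0 l s);
  rewrite 1?(@segment_sum_y1 s b); try lia.
have -> : (s - a = (s - l) + (l - a))%N by lia.
have -> : (b - l = (b - s) + (s - l))%N by lia.
have jaR : (s - l)%:R <= 2 * (l - a)%:R :> R by rewrite -natrM ler_nat.
have jbR : (s - l)%:R <= 2 * (b - s)%:R :> R by rewrite -natrM ler_nat.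
have la0 : 0 <= (l - a)%:R :> R by [].
have DE : `|mu0 - mu1| = `|D| by rewrite distrC.
(* Mirror image of the right-hand case: [s, b) now plays the part of A and [a, l) that of B, with
   the two means exchanged. *)
rewrite !natrD [ltLHS]addrC [ltRHS]addrC.
rewrite [X in X ^+ 2 / ((b - s)%:R + _)]addrC [X in _ < _ + X ^+ 2 / _]addrC.
apply: better_split_noise => //; rewrite ?ltr0n ?subn_gt0 // ?DE.
- by rewrite -oppr_eq0 opprB.
- have := @noise_right (b - s).
  rewrite (_ : s + (b - s) = b)%N; last lia.
  by apply; [lia|lra].
- have := @noise_left (s - l).
  rewrite (_ : s - (s - l) = l)%N; last lia.
  by apply; [lia|lra].
- rewrite addrC -segment_sum_cat; last lia.
  have := @noise_left (s - a).
  rewrite (_ : s - (s - a) = a)%N; last lia.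
  rewrite (_ : s - a = (s - l) + (l - a))%N; last lia.
  rewrite natrD; apply; [lia|lra].
Qed.

Hypothesis energy : 100 * Num.sqrt (penalty R n (p0, s, p1) + zeta ^+ 2) <
   `|D| * scale R (p0, s, p1).
Hypothesis good : forall t, T3 n t -> `|cusum e t| <= lambda R n t + zeta.
Variables (tau l : nat).
Hypotheses (tau_lo : (4 * (tau - s) < minn (s - p0) (p1 - s))%N)
  (tau_hi : (4 * (s - tau) < minn (s - p0) (p1 - s))%N).
Hypothesis improved : is_improved y zeta tau l.

(** Both l and s lie within r - 1 of tau, so they are at most 2r - 2 apart, while the outer radius
    2r - 1 leaves at least r points on each side of both. This is where the length conditions of the
    comparison lemmas come from. *)
Lemma improved_close : `|l%:R - s%:R| < 2 * h0.
Proof.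
have [r [rE r0 [sr1 sr2] lo hi]] :=
  radius_detected p0_ge1 p0s sp1 p1n theta0 theta1 energy good tau_lo tau_hi.
have max_r : maxn (tau - r) 1 = (tau - r)%N by lia.
have min_r : minn (tau + r) n.+1 = (tau + r)%N by lia.
have max_2r : maxn (tau - (2 * r - 1)) 1 = (tau - (2 * r - 1))%N by lia.
have min_2r : minn (tau + (2 * r - 1)) n.+1 = (tau + (2 * r - 1))%N by lia.
have siE x : search_interval y zeta tau x =
    (tau - r + 1 <= x <= tau + r - 1)%N :> Prop.
  by rewrite /search_interval rE /sym_triplet max_r min_r.
have := improved.
rewrite /is_improved /outer_triplet rE /= max_2r min_2r => -[].
rewrite siE => lI /(_ s); rewrite siE => ls.
rewrite ltNge; apply/negP => far.
move: ls; rewrite leNgt => /(_ _)/negP; apply; first by lia.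
have [ls|sl|ls] := ltngtP l s.
- apply: ls_criterion_lt_left; try lia.
  apply: (le_trans far); rewrite distrC natrB ?ger0_norm ?subr_ge0 ?ler_nat //;
    exact: ltnW.
- apply: ls_criterion_lt_right; try lia.
  apply: (le_trans far); rewrite natrB ?ger0_norm ?subr_ge0 ?ler_nat //;
    exact: ltnW.
- by move: far; rewrite ls subrr normr0; have := h0_gt0; lra.
Qed.

End Localization.

Lemma segment_sum_right (R : realType) n (y : 'I_n -> R) (f : nat -> 'I_n) s h :
  (forall i, (i < h)%N -> (f i).+1 = (s + i)%N) ->
  segment_sum y s (s + h) = \sum_(0 <= i < h) y (f i).
Proof.
elim: h => [|h IH] fE; first by rewrite addn0 segment_sum0 big_nil.
rewrite big_nat_recr //= -IH => [|i ih]; last by apply: fE; lia.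
rewrite (@segment_sum_cat _ _ (s + h)); last lia.
by rewrite addnS (@segment_sum1 _ _ _ (f h)) // fE.
Qed.

Lemma segment_sum_left (R : realType) n (y : 'I_n -> R) (f : nat -> 'I_n) s h :
  (h <= s)%N -> (forall i, (i < h)%N -> (f i).+1 = (s - i.+1)%N) ->
  segment_sum y (s - h) s = \sum_(0 <= i < h) y (f i).
Proof.
elim: h => [|h IH] hs fE; first by rewrite subn0 segment_sum0 big_nil.
rewrite big_nat_recr //= -IH => [||i ih]; [|lia|by apply: fE; lia].
rewrite (@segment_sum_cat _ _ (s - h)); last lia.
rewrite addrC -(@segment_sum1 _ _ y (f h) (s - h.+1)); last by rewrite fE.
by rewrite (_ : (s - h.+1).+1 = s - h)%N; last lia.
Qed.

(** * Probability bound *)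

Section Measurability.
Context d (T : measurableType d) (R : realType) (P : probability T R) (n : nat).
Variable eps : 'I_n -> {RV P >-> R}.

Lemma finite_T3 : finite_set (T3 n).
Proof.
apply: (@sub_finite_set _ _ ((`I_n.+2 `*` `I_n.+2) `*` `I_n.+2)).
  by move=> [[t1 t2] t3]; rewrite /T3 /= => /and4P[]; lia.
by apply: finite_setX; [apply: finite_setX|]; exact: finite_II.
Qed.

Lemma measurable_segment_mean a b :
  measurable_fun [set: T] (fun w => segment_mean (fun i => eps i w) a b).
Proof.
apply: measurable_funM => //.
have -> : (fun w => \sum_(i < n | (a <= i.+1 < b)%N) eps i w) =
    (fun w => \sum_(i < n) if (a <= i.+1 < b)%N then eps i w else 0).
  by apply/funext => w; rewrite big_mkcond.
by apply: measurable_sum => i; case: (_ <= _ < _)%N.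
Qed.

Lemma measurable_noise_cusum t : measurable_fun [set: T] (noise_cusum eps t).
Proof.
case: t => [[t1 t2] t3]; apply: measurable_funM => //.
by apply: measurable_funB; exact: measurable_segment_mean.
Qed.

Lemma measurable_good_event zeta : measurable (good_event eps zeta).
Proof.
have -> : good_event eps zeta = \bigcap_(t in T3 n)
    [set w | `|noise_cusum eps t w| <= lambda R n t + zeta].
  by apply/seteqP; split.
apply: fin_bigcap_measurable; first exact: finite_T3.
move=> t _; rewrite -[X in measurable X]setTI.
apply: measurable_fun_le => //.
apply: measurableT_comp => //; exact: measurable_noise_cusum.
Qed.

Lemma measurable_localization_event (L : T -> nat) (s : nat) (zeta C : R) :
  measurable_fun [set: T] L ->
  measurable [set w | C <= `|(L w)%:R - s%:R| * \1_(good_event eps zeta) w].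
Proof.
move=> mL; rewrite -[X in measurable X]setTI; apply: measurable_fun_le => //.
apply: measurable_funM; last exact/measurable_indic/measurable_good_event.
apply: measurableT_comp => //; apply: measurable_funB => //.
by apply: (@measurableT_comp _ _ _ _ _ _ (fun k : nat => k%:R : R) _ L).
Qed.

End Measurability.

Lemma piecewise_le (R : realType) (n K : nat) (theta : 'I_n -> R)
    (taus : nat -> nat) (mu : nat -> R) (i j : nat) :
  piecewise_description theta K taus mu -> (i <= j)%N -> (j <= K.+1)%N ->
  (taus i <= taus j)%N.
Proof.
move=> [_ lt_taus _ _].
elim: j => [|j IH]; first by rewrite leqn0 => /eqP->.
rewrite leq_eqVlt ltnS => /orP[/eqP->//|ij] jK.
by apply: leq_trans (IH ij _) (ltnW (lt_taus j _)) => //; exact: ltnW.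
Qed.

Lemma subgaussian_maximal_abs d (T : measurableType d) (R : realType)
  (P : probability T R) (n : nat) (eps : 'I_n -> {RV P >-> R})
  (f : nat -> 'I_n) (N : nat) (a h0 : R) : 0 < a ->
  mutually_independent eps -> subgaussian eps -> {in gtn N &, injective f} ->
  exists2 E : set T,
    measurable E /\ (P E <= (2 * expR (- (a ^+ 2 / 2 * h0)))%:E)%E &
  forall w (h : nat), ~ E w -> (h <= N)%N -> h0 <= h%:R ->
    `|\sum_(0 <= i < h) eps (f i) w| <= a * h%:R.
Proof.
move=> a0 indep subg finj.
have [E1 [mE1 PE1] H1] := subgaussian_maximal a h0 indep subg finj.
have [E2 [mE2 PE2] H2] := subgaussian_maximal (- a) h0 indep subg finj.
exists (E1 `|` E2).
  split; first exact: measurableU.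
  apply: (le_trans (measureU2 _ mE1 mE2)).
  by rewrite mulr_natl mulr2n EFinD leeD // -[a ^+ 2]sqrrN.
move=> w h /not_orP[nE1 nE2] hN h0h; rewrite leNgt; apply/negP => big.
set S := \sum_(0 <= i < h) _ in big.
have [S0|S0] := leP 0 S.
  apply: nE1; apply: (H1 w h) => //.
  rewrite -/S -mulr_natr expr2 -mulrA ler_pM2l //.
  by rewrite ltW // -(ger0_norm S0).
apply: nE2; apply: (H2 w h) => //; rewrite -/S sqrrN -mulr_natr expr2 -mulrA.
by rewrite mulNr -mulrN ler_pM2l // ltW // -(ltr0_norm S0).
Qed.

Lemma segment_sum_maximal d (T : measurableType d) (R : realType)
    (P : probability T R) (n : nat) (eps : 'I_n -> {RV P >-> R})
    (s : nat) (a h0 : R) : (1 <= s <= n)%N -> 0 < a ->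
  mutually_independent eps -> subgaussian eps ->
  exists2 E : set T,
    measurable E /\ (P E <= (4 * expR (- (a ^+ 2 / 2 * h0)))%:E)%E &
  forall w, ~ E w ->
    (forall h, (s + h <= n.+1)%N -> h0 <= h%:R ->
       `|segment_sum (fun i => eps i w) s (s + h)| <= a * h%:R) /\
    (forall h, (h < s)%N -> h0 <= h%:R ->
       `|segment_sum (fun i => eps i w) (s - h) s| <= a * h%:R).
Proof.
move=> /andP[s_gt0 sn] a0 indep subg.
have n_gt0 : (0 < n)%N by exact: leq_trans s_gt0 sn.
(* [fr] lists the positions s, s + 1, ... and [fl] the positions s - 1, s - 2, ...; the [insubd]
   default is never reached for the lengths considered. *)
pose fr i := insubd (Ordinal n_gt0) (s + i).-1.
pose fl i := insubd (Ordinal n_gt0) (s - i.+1).-1.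
have frE i : (i < n.+1 - s)%N -> (fr i).+1 = (s + i)%N.
  by move=> iN; rewrite /fr insubdK /in_mem /=; lia.
have flE i : (i < s.-1)%N -> (fl i).+1 = (s - i.+1)%N.
  by move=> iN; rewrite /fl insubdK /in_mem /=; lia.
have fr_inj : {in gtn (n.+1 - s)%N &, injective fr}.
  move=> i j; rewrite !inE => iN jN /(congr1 (fun i => (val i).+1)).
  by rewrite /= !frE //; lia.
have fl_inj : {in gtn s.-1 &, injective fl}.
  move=> i j; rewrite !inE => iN jN /(congr1 (fun i => (val i).+1)).
  by rewrite /= !flE //; lia.
have [Er [mEr PEr] Hr] := subgaussian_maximal_abs h0 a0 indep subg fr_inj.
have [El [mEl PEl] Hl] := subgaussian_maximal_abs h0 a0 indep subg fl_inj.
exists (Er `|` El).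
  split; first exact: measurableU.
  apply: (le_trans (measureU2 _ mEr mEl)); apply: (le_trans (leeD PEr PEl)).
  by rewrite -EFinD lee_fin -mulrDl -natrD.
move=> w /not_orP[nEr nEl]; split=> h hs h0h.
  have hN : (h <= n.+1 - s)%N by lia.
  rewrite (@segment_sum_right _ _ _ fr); first exact: Hr.
  by move=> i ih; apply: frE; exact: leq_trans ih hN.
have hN : (h <= s.-1)%N by lia.
rewrite (@segment_sum_left _ _ _ fl); [exact: Hl|exact: ltnW|].
by move=> i ih; apply: flE; exact: leq_trans ih hN.
Qed.

(** From e >= 2 one gets 4 <= e^2, and M >= 1 gives 2 - 3M <= -M <= -x. *)
Lemma expR_union_bound (R : realType) (x : R) :
  4 * expR (- (3 * Num.max x 1)) <= expR (- x).
Proof.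
set M := Num.max x 1.
have xM : x <= M by rewrite le_max lexx.
have M1 : 1 <= M by rewrite le_max lexx orbT.
have e4 : 4 <= expR 2 :> R.
  have e2 : 2 <= expR 1 :> R by have := expR_ge1Dx (1 : R); lra.
  have -> : (2 : R) = 1 + 1 by ring.
  rewrite expRD; have -> : (4 : R) = 2 * 2 by ring.
  by apply: ler_pM.
apply: (@le_trans _ _ (expR 2 * expR (- (3 * M)))).
  by rewrite ler_wpM2r ?expR_ge0.
by rewrite -expRD ler_expR; lra.
Qed.

Theorem proposition13 (R : realType) :
  exists kappa c : R, 0 < kappa /\ 0 < c /\
  forall (d : measure_display) (T : measurableType d) (P : probability T R)
    (n : nat) (eps : 'I_n -> {RV P >-> R}),
  mutually_independent eps -> centered eps -> subgaussian eps ->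
  forall alpha : R, 0 < alpha < 1 ->
  forall zeta : R, is_critical_value eps alpha zeta ->
  forall (theta : 'I_n -> R) (K : nat) (taus : nat -> nat) (mu : nat -> R),
  piecewise_description theta K taus mu ->
  forall k : nat, (1 <= k <= K)%N ->
  high_energy n kappa (zeta ^+ 2) taus mu k ->
  forall tau : nat, (2 <= tau <= n)%N ->
  `|tau%:R - (taus k)%:R| <
    (minn (taus k - taus k.-1) (taus k.+1 - taus k))%:R / 4 :> R ->
  forall L : T -> nat, measurable_fun [set: T] L ->
  (forall w : T, is_improved (fun i => theta i + eps i w) zeta tau (L w)) ->
  forall x : R, 0 < x ->
  (P [set w | (c * (Num.max x 1 / jump mu k ^+ 2)
               <= `|(L w)%:R - (taus k)%:R| * \1_(good_event eps zeta) w)%R]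
   <= (expR (- x))%:E)%E.
Proof.
(* With h0 = c max(x, 1) / (2 D ^ 2), the exponent (D / 20) ^ 2 / 2 * h0 is     *)
(* 3 max(x, 1) for c = 4800, which absorbs the factor 4 of the union bound.     *)
exists 100, 4800; split; [by rewrite ltr0n|split; [by rewrite ltr0n|]].
move=> d T P n eps indep _ subg alpha _ zeta _ theta K taus mu desc k kK energy
  tau taun close L mL improved x x0.
have [[taus0 tausK] lt_taus mu_neq thetaE] := desc.
have kE : k.-1.+1 = k by lia.
have p0s : (taus k.-1 < taus k)%N by rewrite -[in taus k]kE lt_taus //; lia.
have sp1 : (taus k < taus k.+1)%N by apply: lt_taus; lia.
have p0_ge1 : (1 <= taus k.-1)%N.
  by rewrite -taus0; apply: (piecewise_le desc); lia.
have p1n : (taus k.+1 <= n.+1)%N.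
  by rewrite -tausK; apply: (piecewise_le desc); lia.
have theta0 (i : 'I_n) : (taus k.-1 <= i.+1 < taus k)%N -> theta i = mu k.
  by apply: thetaE; lia.
have theta1 (i : 'I_n) : (taus k <= i.+1 < taus k.+1)%N -> theta i = mu k.+1.
  by apply: (thetaE k.+1); lia.
move: energy close; rewrite /high_energy /jump.
set p0 := taus k.-1 in p0s p0_ge1 theta0 *.
set p1 := taus k.+1 in sp1 p1n theta1 *.
set s := taus k in p0s sp1 theta0 theta1 *.
move=> energy; rewrite ltr_pdivlMr // => close.
have s_range : (1 <= s <= n)%N.
  by rewrite (leq_trans p0_ge1 (ltnW p0s)) -ltnS (leq_trans sp1 p1n).
(* The real bound on |tau - s| becomes two inequalities on truncated differences, one of which is
   trivial. *)
have tau_lo : (4 * (tau - s) < minn (s - p0) (p1 - s))%N.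
  rewrite -(ltr_nat R) natrM.
  have [ts|st] := leqP tau s.
    by rewrite (eqP ts) mulr0 (le_lt_trans _ close) // mulr_ge0.
  rewrite mulrC natrB ?(ltnW st) // (le_lt_trans _ close) // ler_wpM2r //.
  exact: ler_norm.
have tau_hi : (4 * (s - tau) < minn (s - p0) (p1 - s))%N.
  rewrite -(ltr_nat R) natrM.
  have [ts|st] := leqP s tau.
    by rewrite (eqP ts) mulr0 (le_lt_trans _ close) // mulr_ge0.
  rewrite mulrC natrB ?(ltnW st) // (le_lt_trans _ close) // ler_wpM2r //.
  by rewrite distrC ler_norm.
set D := mu k.+1 - mu k.
have D0 : D != 0 by rewrite subr_eq0 eq_sym; apply: mu_neq.
have D1 : 0 < `|D| by rewrite normr_gt0.
have D2 : 0 < D ^+ 2 by rewrite lt_def sqr_ge0 sqrf_eq0 D0.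
set M := Num.max x 1.
have M0 : 0 < M by rewrite lt_max ltr01 orbT.
pose h0 := 2400 * (M / D ^+ 2).
have h0_gt0 : 0 < h0 by rewrite mulr_gt0 ?ltr0n ?divr_gt0.
have a0 : 0 < `|D| / 20 by rewrite divr_gt0.
have rate : (`|D| / 20) ^+ 2 / 2 * h0 = 3 * M.
  by rewrite exprMn real_normK ?num_real // /h0; field.
have [E [mE PE] nE] := segment_sum_maximal h0 s_range a0 indep subg.
rewrite rate in PE.
set F := [set w | _].
have FE : F `<=` E.
  move=> w; rewrite /F /= => Fw; apply: contrapT => /nE[noise_r noise_l].
  (* The threshold being positive, the indicator cannot vanish on F: w lies in the good event. *)
  have far0 : 0 < 4800 * (M / D ^+ 2) by rewrite mulr_gt0 ?ltr0n ?divr_gt0.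
  have Bw : good_event eps zeta w.
    move: Fw; rewrite indicE; case: (boolP (w \in _)) => [|_].
      by rewrite inE.
    by rewrite mulr0 => /(lt_le_trans far0); rewrite ltxx.
  move: Fw; rewrite indicE mem_set // mulr1; apply/negP; rewrite -ltNge.
  have -> : 4800 * (M / D ^+ 2) = 2 * h0 by rewrite /h0; ring.
  exact: (@improved_close _ _ p0 s p1 p0_ge1 p0s sp1 p1n theta
    (fun i => eps i w) zeta (mu k) (mu k.+1) theta0 theta1 D0 h0 h0_gt0
    noise_r noise_l energy Bw tau (L w) tau_lo tau_hi (improved w)).
have mF : measurable F by exact: measurable_localization_event.
apply: (@le_trans _ _ (P E)).
  by apply: le_measure => //; rewrite inE.
apply: (le_trans PE); rewrite lee_fin; exact: expR_union_bound.
Qed.
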